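(* Let $X=[x_{ij}]$ be an $n\times n$ doubly stochastic matrix. Then \[ \mathrm{DW}(X)=\theta^*(X)-\theta_*(X), \] where \[ \theta^*(X)=\min\Big\{\sum_i u_i+\sum_j v_j:\ u_i+v_j\ge x_{ij}\ \text{for all }(i,j)\notin\xi(X)\Big\}, \] \[ \theta_*(X)=\max\Big\{\sum_i u_i+\sum_j v_j:\ u_i+v_j\le x_{ij}\ \text{for all }(i,j)\notin\xi(X)\Big\}, \] the optimization being over real vectors $u=(u_1,\ldots,u_n)$, $v=(v_1,\ldots,v_n)$.
   Context: A square nonnegative matrix is doubly stochastic if all row and column sums equal $1$. $\xi(X)$ is the set of positions of the zero entries of $X$. For an $n\times n$ permutation matrix $P$, $d^X_P=\sum_{i,j}p_{ij}x_{ij}$ is the diagonal sum of $X$ corresponding to $P$. Let $\mathcal P_n$ be the set of $n\times n$ permutation matrices. The diagonal width of $X$ is $\mathrm{DW}(X)=\max\{d^X_P: P\in\mathcal P_n,\ \xi(X)\subseteq\xi(P)\}-\min\{d^X_Q: Q\in\mathcal P_n,\ \xi(X)\subseteq\xi(Q)\}$, i.e. the maximum difference between two diagonal sums of $X$ over diagonals avoiding the zeros of $X$. *)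

(* Defs.v *)
From mathcomp Require Import all_boot all_order all_algebra.
From mathcomp Require Import classical_sets reals.

Set Implicit Arguments.
Unset Strict Implicit.
Unset Printing Implicit Defensive.

Import Order.TTheory GRing.Theory Num.Theory.

Local Open Scope classical_set_scope.
Local Open Scope ring_scope.

Section Extrema.
Context {R : realType}.
Implicit Type A : set R.

Definition maxima A : set R := A `&` ubound A.
Definition minima A : set R := A `&` lbound A.

Definition has_max A : Prop := maxima A !=set0.
Definition has_min A : Prop := minima A !=set0.

(* The maximum (minimum) of A when it exists; the junk value 0 otherwise. *)
Definition set_max A : R := xget 0 (maxima A).
Definition set_min A : R := xget 0 (minima A).

End Extrema.

Section DiagonalWidth.
Context {R : realType} {n : nat}.
Implicit Types X P : 'M[R]_n.

Definition doubly_stochastic X : Prop :=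
  [/\ forall i j, 0 <= X i j,
      forall i, \sum_j X i j = 1
    & forall j, \sum_i X i j = 1].

Definition zero_positions X : set ('I_n * 'I_n) :=
  [set ij | X ij.1 ij.2 = 0].

Definition diagonal_sum X P : R := \sum_i \sum_j P i j * X i j.

Definition diagonal_sums X : set R :=
  [set diagonal_sum X P |
    P in [set P | is_perm_mx P /\ zero_positions X `<=` zero_positions P]].

Definition DW X : R := set_max (diagonal_sums X) - set_min (diagonal_sums X).

Definition upper_values X : set R :=
  [set s | exists u v : 'rV[R]_n,
    (forall i j, ~ zero_positions X (i, j) -> u 0 i + v 0 j >= X i j) /\
    s = \sum_i u 0 i + \sum_j v 0 j].

Definition lower_values X : set R :=
  [set s | exists u v : 'rV[R]_n,
    (forall i j, ~ zero_positions X (i, j) -> u 0 i + v 0 j <= X i j) /\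
    s = \sum_i u 0 i + \sum_j v 0 j].

Definition theta_upper X : R := set_min (upper_values X).
Definition theta_lower X : R := set_max (lower_values X).

End DiagonalWidth.

(* Main.v *)
Require Import Defs.
From mathcomp Require Import all_boot all_order all_algebra.
From mathcomp Require Import all_fingroup lra.
From mathcomp Require Import classical_sets reals.

(**
  Egervary duality for a full real matrix W: if s is a permutation of maximal
  weight, the digraph with arc lengths W i (s j) - W j (s j) has no positive
  cycle, and the suprema u of the lengths of simple paths leaving each vertex
  are potentials that give a dual solution tight along s.

  Zero positions are handled by giving them a large negative weight.  A
  doubly stochastic X is itself a fractional solution that never uses a zero
  position, so the dual value, which is the weight of s, is bounded below;
  hence s avoids the zero positions too.  In particular some diagonal avoids
  the zeros of X, with no appeal to Hall's theorem.  Weak duality concludes,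
  with W = X for the maximum and W = - X for the minimum.
*)

Set Implicit Arguments.
Unset Strict Implicit.
Unset Printing Implicit Defensive.

Import Order.TTheory GRing.Theory Num.Theory.
Local Open Scope classical_set_scope.
Local Open Scope ring_scope.

Section Potentials.
Context {R : realType} {T : finType}.
Variable c : T -> T -> R.

Fixpoint walk_length (x : T) (p : seq T) : R :=
  if p is y :: p' then c x y + walk_length y p' else 0.

Lemma walk_length_cat x p q :
  walk_length x (p ++ q) = walk_length x p + walk_length (last x p) q.
Proof. by elim: p x => [|y p IH] x /=; rewrite ?add0r // IH addrA. Qed.

(** The closing vertex [y0] is kept apart from the head [y] so that the induction can move the head
    while the return point stays fixed. *)
Lemma walk_length_next_at y0 y p : uniq (y :: p) ->
  \sum_(k <- y :: p) c k (next_at k y0 y p) = walk_length y (rcons p y0).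
Proof.
elim: p y => [|z p IH] y; first by rewrite big_seq1 /= eqxx addr0.
move=> /= /andP[yzp uzp]; rewrite big_cons eqxx -IH //; congr (_ + _).
apply: eq_big_seq => k kzp; case: eqVneq => // eky.
by rewrite -eky kzp in yzp.
Qed.

(** [next (x :: p)] is a permutation of all of [T] that fixes every vertex off the cycle; those
    terms vanish by [c k k = 0], so its sum is the length of the cycle. *)
Lemma cycle_length_le0 x p :
    (forall k, c k k = 0) ->
    (forall s : {perm T}, \sum_k c k (s k) <= 0) ->
  uniq (x :: p) -> walk_length x (rcons p x) <= 0.
Proof.
move=> c0 cs uxp.
have next_inj : injective (next (x :: p)) by exact: can_inj (prev_next uxp).
have := cs (perm next_inj).
rewrite (bigID (mem (x :: p))) /= [X in _ + X]big1 ?addr0 => [|k kxp]; last first.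
  by rewrite permE next_nth (negPf kxp).
rewrite -big_uniq // -walk_length_next_at //; apply: le_trans.
by rewrite le_eqVlt; apply/orP; left; apply/eqP/eq_bigr => k _; rewrite permE.
Qed.

(** A crude bound; it serves to make the lengths of simple paths bounded, so that their suprema
    exist. *)
Lemma walk_length_le x p :
  walk_length x p <= (\sum_i \sum_j `|c i j|) *+ size p.
Proof.
elim: p x => [|y p IH] x //=; rewrite mulrS lerD //.
rewrite (bigD1 x) //= (bigD1 y) //= -addrA.
apply: (le_trans (ler_norm _)); rewrite lerDl addr_ge0 ?sumr_ge0 // => i _.
by rewrite sumr_ge0.
Qed.

Lemma potential_exists :
    (forall k, c k k = 0) ->
    (forall s : {perm T}, \sum_k c k (s k) <= 0) ->
  exists u : T -> R, forall i j, c i j + u j <= u i.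
Proof.
move=> c0 cs.
pose D i := [set walk_length i p | p in [set p | uniq (i :: p)]].
have D0 i : D i !=set0 by exists 0, [::].
have Dub i : has_ubound (D i).
  exists ((\sum_i \sum_j `|c i j|) *+ #|T|) => _ [p /= /andP[_ up] <-].
  apply: (le_trans (walk_length_le _ _)); apply: ler_wpMn2l.
    by rewrite sumr_ge0 // => k _; rewrite sumr_ge0.
  by rewrite -(card_uniqP up) max_card.
exists (fun i => sup (D i)) => i j.
rewrite addrC -lerBrDr; apply: ge_sup => // _ [p ujp <-].
rewrite lerBrDr addrC -[_ + _]/(walk_length i (j :: p)).
have [ijp|ijp] := boolP (i \in j :: p); last first.
  by apply: ub_le_sup => //; exists (j :: p); rewrite //= ijp.
(* The path from [j] returns to [i]: the arc from [i] to [j] followed by [rcons p1 i] is a cycle of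
   length at most 0, and cutting it off leaves the simple path [p2] from [i]. *)
move: (ujp : uniq (j :: p)).
case/path.splitP: ijp => p1 p2; rewrite cat_uniq rcons_uniq.
move=> /and3P[uip1 disj up2].
rewrite walk_length_cat last_rcons -[leRHS]add0r; apply: lerD.
  exact: cycle_length_le0.
apply: ub_le_sup => //; exists p2 => //=; rewrite up2 andbT.
by apply: contra disj => ip2; apply/hasP; exists i; rewrite // mem_rcons inE eqxx.
Qed.

End Potentials.

Section AssignmentDuality.
Context {R : realType} {n : nat}.
Implicit Types (W X : 'M[R]_n) (s : 'S_n) (u v : 'rV[R]_n).

Lemma assignment_duality W : exists s u v,
  (forall i j, W i j <= u 0 i + v 0 j) /\
  (forall i, W i (s i) = u 0 i + v 0 (s i)).
Proof.
pose F s := \sum_i W i (s i).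
have [s _ smax] := @arg_maxP _ _ _ (1%g : 'S_n) xpredT F isT.
(* The arc length is the gain when column [s j] passes from row [j] to row [i]. Summed along [t] it
   compares the weights of [t * s] and [s]. *)
have [||u0 hu] := @potential_exists R _ (fun i j => W i (s j) - W j (s j)).
- by move=> k; rewrite subrr.
- move=> t; rewrite sumrB subr_le0.
  rewrite -[leRHS](reindex_inj (P := xpredT) (F := fun j => W j (s j)) (@perm_inj _ t)).
  have <- : F (t * s)%g = \sum_i W i (s (t i)).
    by apply: eq_bigr => i _; rewrite permM.
  exact: smax.
(* Tightness along [s] forces this [v]; the potential inequality for rows [i] and [s^-1 j] is then
   dual feasibility at [(i, j)]. *)
exists s, (\row_i u0 i), (\row_j (W (s^-1%g j) j - u0 (s^-1%g j))).
split=> [i j|i]; rewrite !mxE; last by rewrite permK addrC subrK.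
by have := hu i (s^-1%g j); rewrite permKV; lra.
Qed.

Lemma doubly_stochastic_le1 X i j : doubly_stochastic X -> X i j <= 1.
Proof.
by case=> X0 row1 _; rewrite -(row1 i) (bigD1 j) //= lerDl sumr_ge0.
Qed.

Lemma doubly_stochastic_potential X u v : doubly_stochastic X ->
  \sum_i \sum_j X i j * (u 0 i + v 0 j) = \sum_i u 0 i + \sum_j v 0 j.
Proof.
case=> _ row1 col1.
under eq_bigr do (under eq_bigr do rewrite mulrDr; rewrite big_split /=).
rewrite big_split /=; congr (_ + _).
  by apply: eq_bigr => i _; rewrite -mulr_suml row1 mul1r.
by rewrite exchange_big; apply: eq_bigr => j _; rewrite -mulr_suml col1 mul1r.
Qed.

Lemma tight_sum W s u v : (forall i, W i (s i) = u 0 i + v 0 (s i)) ->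
  \sum_i W i (s i) = \sum_i u 0 i + \sum_j v 0 j.
Proof.
move=> tight; rewrite (eq_bigr _ (fun i _ => tight i)) big_split /=.
by rewrite -(reindex_inj (P := xpredT) (F := v 0) (@perm_inj _ s)).
Qed.

Lemma supported_assignment_duality X W : doubly_stochastic X ->
    (forall i j, `|W i j| <= 1) ->
  exists s u v,
  [/\ forall i, X i (s i) != 0,
      forall i j, X i j != 0 -> W i j <= u 0 i + v 0 j
    & forall i, W i (s i) = u 0 i + v 0 (s i)].
Proof.
move=> dX W1; have [X0 row1 _] := dX.
(* One zero position on [s] would bring the weight down to at most [- M + n = - n - 1], just below
   the bound [- n] proved next. *)
pose M : R := (n + n).+1%:R.
pose W' := \matrix_(i, j) (if X i j == 0 then - M else W i j).
have W'1 i j : W' i j <= 1.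
  rewrite mxE; case: ifP => _; last exact: le_trans (ler_norm _) (W1 i j).
  by apply: (@le_trans _ _ 0) => //; rewrite oppr_le0.
have [s [u [v [dual tight]]]] := assignment_duality W'.
(* The weight of [s] is the dual value, hence the [X]-average of [u i + v j], which dominates that
   of [W']. There the penalty is multiplied by 0, and the other entries are at least -1. *)
have lower : - n%:R <= \sum_i W' i (s i).
  rewrite (tight_sum tight) -(doubly_stochastic_potential u v dX).
  rewrite -[in leLHS](card_ord n) -sumr_const -sumrN.
  apply: ler_sum => i _; rewrite -(row1 i) -sumrN; apply: ler_sum => j _.
  apply: (@le_trans _ _ (X i j * W' i j)); last exact: ler_wpM2l.
  rewrite mxE; case: eqVneq => [->|_]; first by rewrite mul0r oppr0.
  by rewrite -mulrN1; apply: ler_wpM2l => //; have := W1 i j; rewrite ler_norml => /andP[].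
have supp i : X i (s i) != 0.
  apply/negP => Xi0; suff : \sum_i W' i (s i) < - n%:R by rewrite ltNge lower.
  rewrite (bigD1 i) //= {1}mxE Xi0.
  have : \sum_(k | k != i) W' k (s k) <= n%:R.
    apply: (@le_trans _ _ (\sum_(k | k != i) 1)); first exact: ler_sum.
    by rewrite sumr_const ler_nat (leq_trans (max_card _)) ?card_ord.
  by rewrite /M -addn1 !natrD; lra.
exists s, u, v; split=> // [i j Xij|i].
  by have := dual i j; rewrite mxE (negPf Xij).
by have := tight i; rewrite mxE (negPf (supp i)).
Qed.

End AssignmentDuality.

Section Extrema.
Context {R : realType}.
Implicit Types (A B : set R) (x : R).

Lemma set_max_unique A x : maxima A x -> set_max A = x.
Proof.
move=> Ax; apply: xget_unique => // y [Ay uy]; case: Ax => Ax ux.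
by apply/eqP; rewrite eq_le ux // uy.
Qed.

Lemma set_min_unique A x : minima A x -> set_min A = x.
Proof.
move=> Ax; apply: xget_unique => // y [Ay ly]; case: Ax => Ax lx.
by apply/eqP; rewrite eq_le ly // lx.
Qed.

Lemma common_point_extrema A B x :
  (forall a b, A a -> B b -> a <= b) -> A x -> B x -> maxima A x /\ minima B x.
Proof. by move=> AB Ax Bx; split; split=> // y ?; apply: AB. Qed.

End Extrema.

Section WidthDuality.
Context {R : realType} {n : nat}.
Implicit Types X : 'M[R]_n.

Lemma diagonal_sum_perm_mx X (s : 'S_n) :
  diagonal_sum X (perm_mx s) = \sum_i X i (s i).
Proof.
apply: eq_bigr => i _; rewrite (bigD1 (s i)) //= big1 ?addr0 => [|j js].
  by rewrite !mxE eqxx mul1r.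
by rewrite !mxE eq_sym (negPf js) mul0r.
Qed.

Lemma diagonal_sumsP X x : diagonal_sums X x <->
  exists2 s : 'S_n, forall i, X i (s i) != 0 & x = \sum_i X i (s i).
Proof.
split=> [[P [/is_perm_mxP[s ->] zP] <-]|[s Xs ->]].
  exists s; last exact: diagonal_sum_perm_mx.
  move=> i; apply/eqP => Xi0; have := zP (i, s i) Xi0.
  by rewrite /zero_positions /= !mxE eqxx => /eqP; rewrite oner_eq0.
exists (perm_mx s); last exact: diagonal_sum_perm_mx.
split; first exact: perm_mx_is_perm.
move=> [i j]; rewrite /zero_positions /= => Xij; rewrite !mxE.
by case: eqVneq => // sij; have := Xs i; rewrite sij Xij eqxx.
Qed.

(** Weak duality: the constraints are summed along [s], whose positions all lie off the zeros of
    [X]. *)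
Lemma diagonal_sum_le_upper X x y :
  diagonal_sums X x -> upper_values X y -> x <= y.
Proof.
move=> /diagonal_sumsP[s Xs ->] [u [v [uv ->]]].
rewrite (reindex_inj (P := xpredT) (F := v 0) (@perm_inj _ s)) -big_split /=.
by apply: ler_sum => i _; apply: uv; apply/eqP.
Qed.

Lemma lower_le_diagonal_sum X x y :
  lower_values X x -> diagonal_sums X y -> x <= y.
Proof.
move=> [u [v [uv ->]]] /diagonal_sumsP[s Xs ->].
rewrite (reindex_inj (P := xpredT) (F := v 0) (@perm_inj _ s)) -big_split /=.
by apply: ler_sum => i _; apply: uv; apply/eqP.
Qed.

Lemma upper_attained X : doubly_stochastic X ->
  exists x, diagonal_sums X x /\ upper_values X x.
Proof.
move=> dX; have [X0 _ _] := dX.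
have [|s [u [v [Xs dual tight]]]] := @supported_assignment_duality _ _ _ X dX.
  by move=> i j; rewrite ger0_norm // doubly_stochastic_le1.
exists (\sum_i X i (s i)); split; first by apply/diagonal_sumsP; exists s.
exists u, v; split; last exact: tight_sum.
by move=> i j /eqP; exact: dual.
Qed.

Lemma lower_attained X : doubly_stochastic X ->
  exists x, lower_values X x /\ diagonal_sums X x.
Proof.
move=> dX; have [X0 _ _] := dX.
have [|s [u [v [Xs dual tight]]]] := @supported_assignment_duality _ _ _ (- X) dX.
  by move=> i j; rewrite mxE normrN ger0_norm // doubly_stochastic_le1.
exists (\sum_i X i (s i)); split; last by apply/diagonal_sumsP; exists s.
(* Negating a dual solution for [- X] turns covering from above into covering from below. *)
exists (- u), (- v); split.
  by move=> i j /eqP /dual; rewrite !mxE; lra.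
apply: tight_sum => i; have := tight i; rewrite !mxE; lra.
Qed.

End WidthDuality.

Theorem theorem6p1 (R : realType) (n : nat) (X : 'M[R]_n)
    (hX : doubly_stochastic X) :
  [/\ has_max (diagonal_sums X) /\ has_min (diagonal_sums X),
      has_min (upper_values X),
      has_max (lower_values X)
    & DW X = theta_upper X - theta_lower X].
Proof.
have [x [Dx Ux]] := upper_attained hX.
have [y [Ly Dy]] := lower_attained hX.
(* By weak duality a value shared by the primal and dual sets is optimal for both, so all four
   extrema are attained, at [x] or at [y]. *)
have [maxD minU] := common_point_extrema (@diagonal_sum_le_upper _ _ X) Dx Ux.
have [maxL minD] := common_point_extrema (@lower_le_diagonal_sum _ _ X) Ly Dy.
split; [split; [by exists x|by exists y]|by exists x|by exists y|].
rewrite /DW /theta_upper /theta_lower.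
by rewrite !(set_max_unique maxD, set_max_unique maxL,
  set_min_unique minD, set_min_unique minU).
Qed.
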